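(* Let $0<\alpha<1$, $\kappa>0$, $\epsilon>0$, and let $0=t_0<t_1<\cdots<t_N=T$ be an arbitrary time mesh with steps $\tau_n=t_n-t_{n-1}$. Suppose that $$\tau_n\le \frac{1}{\sqrt[\alpha]{\kappa\,\Gamma(2-\alpha)}}\qquad\text{for } 1\le n\le N .$$ Then the fully implicit L1 scheme $$\sum_{k=1}^{n}a_{n-k}^{(n)}\big(\phi_h^{k}-\phi_h^{k-1}\big)=-\kappa\mu_h^n,\qquad \mu_h^n:=(\phi_h^n)^3-\phi_h^n-\epsilon^2\Delta_h\phi_h^n,\qquad 1\le n\le N,$$ with the given initial grid function $\phi_h^0=\Phi_0(\mathbf{x}_h)$ and periodic boundary conditions is uniquely solvable, i.e. there is exactly one sequence $\phi^1,\dots,\phi^N\in\mathbb{V}_h$ satisfying these equations at all grid points.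
   Context: Spatial grid: $\Omega=(0,L)^2$, $h=L/M$ for an integer $M$, grid points $\mathbf{x}_h=(ih,jh)$, and $\mathbb{V}_h$ is the space of real grid functions $v=(v_h)$ that are $L$-periodic in each coordinate direction. $\Delta_h$ is the standard second-order central (five-point) difference Laplacian acting on periodic grid functions. Powers of grid functions are pointwise. $\Phi_0$ is a given $L$-periodic initial function. L1 kernels: with $\omega_\beta(t):=t^{\beta-1}/\Gamma(\beta)$, $$a_{n-k}^{(n)}:=\frac{1}{\tau_k}\int_{t_{k-1}}^{t_k}\omega_{1-\alpha}(t_n-s)\,\mathrm{d}s,\qquad 1\le k\le n.$$ *)

(* Defs.v *)
From mathcomp Require Import all_boot all_order all_algebra.
From mathcomp Require Import all_classical all_reals all_analysis.
Set Implicit Arguments.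
Unset Strict Implicit.
Unset Printing Implicit Defensive.
Import Order.TTheory GRing.Theory Num.Theory.
Import numFieldNormedType.Exports.
Local Open Scope classical_set_scope.
Local Open Scope ring_scope.

(* Euler's Gamma function.  The integral is a Lebesgue integral, finite exactly
   for x > 0; [Rintegral] gives the value 0 when it diverges. *)
Definition Gamma {R : realType} (x : R) : R :=
  \int[lebesgue_measure]_(s in `]0, +oo[) (s `^ (x - 1) * expR (- s)).

Definition omega {R : realType} (beta t : R) : R := t `^ (beta - 1) / Gamma beta.

(* The step tau_n = t_n - t_(n-1), used only for n >= 1. *)
Definition tstep {R : realType} (t : nat -> R) (n : nat) : R := t n - t n.-1.

(* [L1_kernel alpha t n k] is a^(n)_(n-k), for 1 <= k <= n.  For k = n the
   integrand is singular at the endpoint s = t_n; its junk value there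
   (0 `^ (- alpha) = 0) does not affect the Lebesgue integral. *)
Definition L1_kernel {R : realType} (alpha : R) (t : nat -> R) (n k : nat) : R :=
  (tstep t k)^-1 *
  \int[lebesgue_measure]_(s in `[t k.-1, t k]) omega (1 - alpha) (t n - s).

(* Grid functions are functions on the whole grid {(i h, j h) | i, j in Z},
   written in terms of the indices (i, j); since L = M h, L-periodicity in each
   coordinate direction is M-periodicity in each index. *)
Definition Vh {R : realType} (M : nat) : set (int -> int -> R) :=
  [set v | forall i j, v (i + M%:Z) j = v i j /\ v i (j + M%:Z) = v i j].

Definition laplacian_h {R : realType} (h : R) (v : int -> int -> R) :
    int -> int -> R := fun i j =>
  (v (i + 1) j - 2 * v i j + v (i - 1) j) / h ^+ 2 +
  (v i (j + 1) - 2 * v i j + v i (j - 1)) / h ^+ 2.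

Definition chem_potential {R : realType} (eps h : R) (v : int -> int -> R) :
    int -> int -> R := fun i j =>
  v i j ^+ 3 - v i j - eps ^+ 2 * laplacian_h h v i j.

(* phi^0, ..., phi^N solve the scheme: each level is a periodic grid function,
   phi^0 is the restriction of Phi0 to the grid, and the equation holds at
   every grid point and every time level 1 <= n <= N. *)
Definition L1_solution {R : realType} (alpha kappa eps h : R) (M N : nat)
    (t : nat -> R) (Phi0 : R -> R -> R) (phi : 'I_N.+1 -> int -> int -> R) : Prop :=
  [/\ forall n, Vh M (phi n),
      forall i j, phi ord0 i j = Phi0 (i%:~R * h) (j%:~R * h)
    & forall n : nat, (1 <= n <= N)%N -> forall i j : int,
        \sum_(1 <= k < n.+1)
          L1_kernel alpha t n k * (phi (inord k) i j - phi (inord k.-1) i j)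
        = - kappa * chem_potential eps h (phi (inord n)) i j].

(* Main.v *)
(* Since Gamma (2 - alpha) = (1 - alpha) Gamma (1 - alpha), the diagonal kernel
   is tau_n^(-alpha) / Gamma (2 - alpha), so the step
   restriction says exactly that it is at least kappa; the destabilising term
   - kappa phi^n is then absorbed.  One step amounts to solving
     A v + kappa v^3 - K (sum of the four neighbours of v) = g
   with A >= 4 K >= 0.  Uniqueness follows from the maximum principle, comparing
   two solutions where their difference is maximal.  For existence, solve the
   scalar cubic for v in terms of its neighbours: this gives a monotone map
   preserving the grid functions with values in [-B, B] for B large, which has a
   fixed point by Knaster-Tarski. *)
Require Import Defs.
From mathcomp Require Import all_boot all_order all_algebra.
From mathcomp Require Import all_classical all_reals all_analysis.
From mathcomp Require Import measurable_realfun ring lra.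
Import Order.TTheory GRing.Theory Num.Theory.
Import numFieldNormedType.Exports.
Local Open Scope classical_set_scope.
Local Open Scope ring_scope.

(** * Improper integrals from the fundamental theorem of calculus *)

(** The fundamental theorem is applied to [f - g]. The integral of [g] stands on the right as a
    summand, so that the identity survives a limit in which both integrals may become infinite. *)
Lemma integral_segment_FTC2_diff {R : realType} (f g F : R -> R) (a b : R) :
    a < b ->
    {in `[a, b], continuous f} -> {in `[a, b], continuous g} ->
    (forall x, x \in `[a, b] -> is_derive x 1 F (f x - g x)) ->
  (\int[lebesgue_measure]_(x in `[a, b]) (f x)%:E =
   \int[lebesgue_measure]_(x in `[a, b]) (g x)%:E + (F b - F a)%:E)%E.
Proof.
move=> ab cf cg dF.
have within (h : R -> R) : {in `[a, b], continuous h} ->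
    {within `[a, b], continuous h}.
  by move=> ch; apply: continuous_in_subspaceT => x /[!inE] xab; exact: ch.
have int (h : R -> R) : {in `[a, b], continuous h} ->
    lebesgue_measure.-integrable `[a, b] (EFin \o h).
  move=> ch; apply: continuous_compact_integrable; first exact: segment_compact.
  exact: within.
have cF x : x \in `[a, b] -> {for x, continuous F}.
  by move=> xab; apply: differentiable_continuous; apply/derivable1_diffP;
     have [] := dF x xab.
have aab : a \in `[a, b] by rewrite in_itv/= lexx ltW.
have bab : b \in `[a, b] by rewrite in_itv/= lexx ltW.
have := @continuous_FTC2 R (f \- g) F a b ab; rewrite -EFinB => <-.
- have fin : (\int[lebesgue_measure]_(x in `[a, b]) (g x)%:E)%E \is a fin_num.
    exact: integrable_fin_num (int _ cg).
  under [X in (_ + X)%E]eq_integral do rewrite EFinB.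
  rewrite (integralB_EFin _ (int _ cf) (int _ cg))//.
  by rewrite addeCA subee// adde0.
- apply: within => x xab.
  by apply: continuousB; [exact: cf|exact: cg].
- split.
  + by move=> x xab; have [] := dF x (subset_itv_oo_cc xab).
  + exact: cvg_at_right_filter (cF _ aab).
  + exact: cvg_at_left_filter (cF _ bab).
- move=> x xab; have dFx := dF x (subset_itv_oo_cc xab).
  by rewrite derive1E derive_val.
Qed.

(* With [g := 0] this is an improper fundamental theorem (for the kernel); with
   nonzero [g] it is an improper integration by parts (for Gamma). *)
Lemma ge0_integral_bigcup_FTC2_diff {R : realType} (f g F : R -> R)
    (u v : R^nat) (l : R) :
    (forall n, u n < v n) -> nonincreasing_seq u -> nondecreasing_seq v ->
    (forall n, {in `[u n, v n], forall x, 0 <= f x}) ->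
    (forall n, {in `[u n, v n], forall x, 0 <= g x}) ->
    (forall n, {in `[u n, v n], continuous f}) ->
    (forall n, {in `[u n, v n], continuous g}) ->
    (forall n x, x \in `[u n, v n] -> is_derive x 1 F (f x - g x)) ->
    F (v n) - F (u n) @[n --> \oo] --> l ->
  (\int[lebesgue_measure]_(x in \bigcup_n [set` `[u n, v n]]) (f x)%:E =
   \int[lebesgue_measure]_(x in \bigcup_n [set` `[u n, v n]]) (g x)%:E + l%:E)%E.
Proof.
move=> uv du iv f0 g0 cf cg dF Fl.
have cvgI (h : R -> R) : (forall n, {in `[u n, v n], forall x, 0 <= h x}) ->
    (forall n, {in `[u n, v n], continuous h}) ->
    (\int[lebesgue_measure]_(x in `[u n, v n]) (h x)%:E @[n --> \oo] -->
     \int[lebesgue_measure]_(x in \bigcup_n [set` `[u n, v n]]) (h x)%:E)%E.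
  move=> h0 ch; apply: ge0_nondecreasing_set_cvg_integral.
  - move=> m n mn; apply/subsetPset; apply: subset_itvScc; rewrite bnd_simp.
      exact: du.
    exact: iv.
  - by move=> n; exact: measurable_itv.
  - move=> n; apply/measurable_EFinP.
    apply: subspace_continuous_measurable_fun; first exact: measurable_itv.
    by apply: continuous_in_subspaceT => x /[!inE] xab; exact: ch xab.
  - by move=> n x xab; rewrite lee_fin; exact: h0 xab.
have := cvgI f f0 cf.
under eq_fun do rewrite (integral_segment_FTC2_diff _ _ _ _ _ (uv _) (cf _) (cg _) (dF _)).
move=> /cvg_unique; apply; first exact: ereal_hausdorff.
apply: cvgeD; first exact: fin_num_adde_defl.
  exact: cvgI.
by apply: cvg_EFin => //; near=> n.
Unshelve. all: by end_near. Qed.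

(** * The Gamma integral: recurrence, finiteness and positivity *)

Lemma bigcup_segment_gt0 {R : realType} :
  \bigcup_n [set` `[(n.+2%:R^-1 : R), n.+1%:R]] = `]0, +oo[%classic.
Proof.
apply/seteqP; split=> [x [n _]|x] /=; rewrite !in_itv/= ?andbT.
  by case/andP => + _; apply: lt_le_trans; rewrite invr_gt0 ltr0n.
move=> x0; exists (maxn (Num.truncn x) (Num.truncn x^-1)) => //=.
rewrite in_itv/= -[leLHS]div1r ler_pdivrMr ?ltr0n//.
apply/andP; split.
  rewrite -ler_pdivrMl// mulr1 (le_trans (ltW (truncnS_gt _)))//.
  by rewrite ler_nat ltnS leqW ?leq_maxr.
rewrite (le_trans (ltW (truncnS_gt _)))//.
by rewrite ler_nat ltnS leq_maxl.
Qed.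

Lemma continuous_powR_gt0 {R : realType} (p x : R) : 0 < x ->
  {for x, continuous (@powR R ^~ p)}.
Proof.
move=> x0; apply: differentiable_continuous; apply/derivable1_diffP.
by apply: derivable_powR; rewrite in_itv/= x0.
Qed.

Lemma continuous_expRN {R : realType} : continuous (fun x : R => expR (- x)).
Proof.
move=> x; apply: continuous_comp; last exact: continuous_expR.
exact: continuousN.
Qed.

Lemma continuous_Gamma_integrand {R : realType} (p x : R) : 0 < x ->
  {for x, continuous (fun s : R => s `^ p * expR (- s))}.
Proof.
move=> x0; apply: continuousM; first exact: continuous_powR_gt0.
exact: continuous_expRN.
Qed.

(** One factor e^(-s/2) of e^(-s) absorbs s^p <= 1 + s <= 2 e^(s/2); the other remains. The bound
    serves twice, for decay at infinity and as an integrable majorant. *)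
Lemma powR_expRN_le {R : realType} (p s : R) : 0 <= p <= 1 -> 0 < s ->
  s `^ p * expR (- s) <= 2 * expR (- (s / 2)).
Proof.
move=> /andP[p0 p1] s0.
have -> : expR (- s) = expR (- (s / 2)) * expR (- (s / 2)).
  by rewrite -expRD; congr expR; lra.
rewrite mulrA ler_wpM2r ?expR_ge0// expRN ler_pdivrMr ?expR_gt0//.
have sp : s `^ p <= 1 + s.
  have [s1|/ltW s1] := leP s 1.
    have : s `^ p <= 1 `^ p by apply: ge0_ler_powR; rewrite ?nnegrE ?(ltW s0).
    by rewrite powR1 => /le_trans; apply; rewrite lerDl ltW.
  by rewrite (le_trans (ler1_powR s1 p1))// lerDr ler01.
by have := expR_ge1Dx (s / 2); lra.
Qed.

(** Integration by parts with s^p e^(-s), whose boundary values vanish at both ends. The equality is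
    in the extended reals, before either side is known to be finite. *)
Lemma integral_Gamma_rec {R : realType} (p : R) : 0 < p <= 1 ->
  (\int[lebesgue_measure]_(s in `]0%R, +oo[) (p * (s `^ (p - 1) * expR (- s)))%:E =
   \int[lebesgue_measure]_(s in `]0%R, +oo[) (s `^ p * expR (- s))%:E)%E.
Proof.
move=> /andP[p0 p1]; rewrite -bigcup_segment_gt0 -[RHS]adde0.
have pos (n : nat) (x : R) : x \in `[(n.+2%:R^-1), n.+1%:R] -> 0 < x.
  rewrite in_itv/= => /andP[+ _]; apply: lt_le_trans.
  by rewrite invr_gt0 ltr0n.
apply: (@ge0_integral_bigcup_FTC2_diff _ _ _ (fun s => s `^ p * expR (- s))).
- move=> n; apply: (@lt_le_trans _ _ 1); last by rewrite ler1n.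
  by rewrite invf_lt1 ?ltr0n// ltr1n.
- by move=> m n mn; rewrite lef_pV2 ?posrE ?ltr0n// ler_nat.
- by move=> m n mn; rewrite ler_nat.
- by move=> n x xn; rewrite !mulr_ge0 ?powR_ge0 ?expR_ge0// ltW.
- by move=> n x xn; rewrite !mulr_ge0 ?powR_ge0 ?expR_ge0.
- move=> n x /pos x0; apply: cvgMl_tmp.
  exact: continuous_Gamma_integrand.
- by move=> n x /pos x0; exact: continuous_Gamma_integrand.
- move=> n x /pos x0.
  have dp := is_derive1_powR p x0.
  apply: is_derive_eq.
  by rewrite /GRing.scale/=; ring.
(* At infinity the boundary term is squeezed by [powR_expRN_le]; at 0 it vanishes because p > 0. *)
- rewrite -[X in _ --> X]subr0; apply: cvgB.
  + apply: (@squeeze_cvgr _ _ _ _ (cst 0) (fun n => 2 * expR (- (n.+1%:R / 2)))).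
    * near=> n; rewrite mulr_ge0 ?powR_ge0 ?expR_ge0//=.
      by apply: powR_expRN_le; rewrite ?ltr0n// ltW.
    * exact: cvg_cst.
    * rewrite -(mulr0 2); apply: cvgMl_tmp.
      apply: (@cvg_comp _ _ _ (fun n => n.+1%:R) (fun x : R => expR (- (x / 2))) _
        (pinfty_nbhs R)); first by rewrite (cvg_shiftS (fun n => n%:R : R)); exact: cvgr_idn.
      apply: (@cvg_comp _ _ _ (fun x : R => x / 2) (fun x => expR (- x)) _
        (pinfty_nbhs R)); last exact: cvgr_expR.
      by apply: gt0_cvgMly; [rewrite invr_gt0|exact: cvg_id].
  + suff /cvg_at_rightP : s `^ p * expR (- s) @[s --> 0^'+] --> (0 : R).
      apply; split=> [n|]; first by rewrite invr_gt0 ltr0n.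
      by rewrite (cvg_shiftS (@harmonic R)); exact: cvg_harmonic.
    rewrite -[X in _ --> X](mul0r (expR (- 0))); apply: cvgM.
      exact: powR_cvg0.
    by apply: cvg_at_right_filter; exact: continuous_expRN.
Unshelve. all: by end_near. Qed.

Lemma measurable_Gamma_integrand {R : realType} (p : R) :
  measurable_fun (`]0, +oo[ : set R) (fun s : R => s `^ p * expR (- s)).
Proof.
apply: open_continuous_measurable_fun => // x.
by rewrite inE/= in_itv/= andbT; exact: continuous_Gamma_integrand.
Qed.

Lemma integral_Gamma_lty {R : realType} (p : R) : 0 <= p <= 1 ->
  (\int[lebesgue_measure]_(s in `]0%R, +oo[) (s `^ p * expR (- s))%:E < +oo)%E.
Proof.
move=> p01.
(* Four times the exponential density of rate 1/2 is 2 e^(-s/2), the majorant of [powR_expRN_le]. *)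
have int4 : (@lebesgue_measure R).-integrable `]0%R, +oo[
    (fun s => 4%:E * (exponential_pdf 2^-1 s)%:E)%E.
  apply: (@integrableS _ _ _ _ setT) => //.
  by apply: integrableZl => //; apply: integrable_exponential_pdf; rewrite invr_gt0.
have /integrableP[_] : (@lebesgue_measure R).-integrable `]0%R, +oo[
    (fun s => (s `^ p * expR (- s))%:E).
  apply: le_integrable int4 => //=.
  - by apply/measurable_EFinP; exact: measurable_Gamma_integrand.
  - move=> s; rewrite /= in_itv/= andbT => s0; rewrite lee_fin exponential_pdfE ?(ltW s0)//.
    rewrite !ger0_norm ?mulr_ge0 ?invr_ge0 ?powR_ge0 ?expR_ge0//.
    rewrite (le_trans (powR_expRN_le _ _ p01 s0))//.
    by rewrite mulNr (mulrC _ s) mulrA ler_wpM2r ?expR_ge0//; lra.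
by under eq_integral do rewrite gee0_abs ?lee_fin ?mulr_ge0 ?powR_ge0 ?expR_ge0//.
Qed.

Lemma Gamma_integralZl {R : realType} (p : R) : 0 < p <= 1 ->
  (p%:E * \int[lebesgue_measure]_(s in `]0%R, +oo[) (s `^ (p - 1) * expR (- s))%:E =
   \int[lebesgue_measure]_(s in `]0%R, +oo[) (s `^ p * expR (- s))%:E)%E.
Proof.
move=> p01; have /andP[p0 _] := p01.
rewrite -(integral_Gamma_rec p)//; under [in RHS]eq_integral do rewrite EFinM.
rewrite ge0_integralZl//=.
- by apply/measurable_EFinP; exact: measurable_Gamma_integrand.
- by move=> s _; rewrite lee_fin mulr_ge0 ?powR_ge0 ?expR_ge0.
- by rewrite lee_fin ltW.
Qed.

(** The singularity at 0 is not estimated: were the integral infinite, so would be its multiple by p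
    > 0, which equals the finite integral of s^p e^(-s). *)
Lemma Gamma_integral_fin_num {R : realType} (p : R) : 0 < p <= 1 ->
  (\int[lebesgue_measure]_(s in `]0%R, +oo[)
    (s `^ (p - 1) * expR (- s))%:E)%E \is a fin_num.
Proof.
move=> p01; have /andP[p0 p1] := p01.
have I0 : (0 <= \int[lebesgue_measure]_(s in `]0%R, +oo[)
    (s `^ (p - 1) * expR (- s))%:E)%E.
  by apply: integral_ge0 => s _; rewrite lee_fin mulr_ge0 ?powR_ge0 ?expR_ge0.
rewrite ge0_fin_numE// ltey; apply/eqP => Ioo.
have := integral_Gamma_lty p; rewrite -Gamma_integralZl// Ioo gt0_muley ?lte_fin//.
by rewrite ltxx (ltW p0) p1 => /(_ isT).
Qed.

Lemma GammaS {R : realType} (p : R) : 0 < p <= 1 -> Gamma (p + 1) = p * Gamma p.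
Proof.
move=> p01; rewrite /Gamma addrK /Rintegral -Gamma_integralZl//.
by rewrite fineM// Gamma_integral_fin_num.
Qed.

Lemma Gamma_gt0 {R : realType} (p : R) : 0 < p <= 1 -> 0 < Gamma p.
Proof.
move=> p01; have /andP[p0 p1] := p01.
rewrite /Gamma /Rintegral -lte_fin fineK ?Gamma_integral_fin_num//.
(* On ]0, 1] the integrand is at least e^(-1), since s^(p-1) >= 1 for p <= 1. *)
apply: (@lt_le_trans _ _ (expR (- 1))%:E); first by rewrite lte_fin expR_gt0.
have -> : (expR (- 1))%:E =
    (\int[@lebesgue_measure R]_(s in `]0%R, 1%R]) (expR (- 1))%:E)%E.
  rewrite integral_cst//= lebesgue_measure_itv/= lte_fin ltr01.
  by rewrite -EFinB subr0 mule1.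
have sub : `]0%R, 1%R] `<=` (`]0%R, +oo[ : set R).
  by move=> s /=; rewrite !in_itv/= andbT => /andP[].
apply: (@le_trans _ _ (\int[lebesgue_measure]_(s in `]0%R, 1%R])
    (s `^ (p - 1) * expR (- s))%:E)%E).
  apply: ge0_le_integral => //.
  - apply/measurable_EFinP.
    by apply: measurable_funS sub (measurable_Gamma_integrand _).
  - move=> s; rewrite /= in_itv/= => /andP[s0 s1]; rewrite lee_fin.
    rewrite -[leLHS]mul1r ler_pM ?expR_ge0 ?ler_expR ?lerN2//.
    rewrite -[leLHS](powRr0 s) ger_powR ?s0//; lra.
apply: ge0_subset_integral => //.
- by apply/measurable_EFinP; exact: measurable_Gamma_integrand.
- by move=> s _; rewrite lee_fin mulr_ge0 ?powR_ge0 ?expR_ge0.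
Qed.

(** * The diagonal kernel and the step restriction *)

(** The offset [n.+2] keeps even the first segment nondegenerate, as [ge0_integral_bigcup_FTC2_diff]
    demands. *)
Lemma bigcup_segment_bndo {R : realType} (a b : R) : a < b ->
  \bigcup_n [set` `[a, b - (b - a) * n.+2%:R^-1]] = `[a, b[%classic.
Proof.
move=> ab; have d0 : 0 < b - a by rewrite subr_gt0.
apply/seteqP; split=> [x [n _]|x] /=; rewrite !in_itv/= => /andP[ax xb].
  rewrite ax (le_lt_trans xb)// ltrBlDl ltrDr.
  by rewrite mulr_gt0 ?invr_gt0 ?ltr0n.
have bx : 0 < b - x by rewrite subr_gt0.
exists (Num.truncn ((b - a) / (b - x))) => //=; rewrite in_itv/= ax/=.
rewrite lerBrDl -lerBrDr ler_pdivrMr ?ltr0n// -ler_pdivrMl// mulrC.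
by rewrite (le_trans (ltW (truncnS_gt _)))// ler_nat.
Qed.

Lemma integral_powR_endpoint {R : realType} (p a b : R) : 0 < p -> a < b ->
  (\int[lebesgue_measure]_(s in `[a, b]) ((b - s) `^ (p - 1))%:E =
   ((b - a) `^ p / p)%:E)%E.
Proof.
move=> p0 ab; have d0 : 0 < b - a by rewrite subr_gt0.
have mf : measurable_fun `[a, b[ (fun s => (b - s) `^ (p - 1)).
  apply: measurable_funTS; apply: (measurableT_comp (measurable_powR _)).
  exact: measurable_funB.
(* The endpoint b is a null set; without it the domain is exhausted by segments on which the
   integrand is continuous. *)
rewrite -integral_itv_bndo_bndc; last exact/measurable_EFinP.
rewrite -(bigcup_segment_bndo _ _ ab).
have small n : (b - a) * n.+2%:R^-1 < b - a.
  by rewrite -[ltRHS]mulr1 ltr_pM2l// invf_lt1 ?ltr0n// ltr1n.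
have pos n (x : R) : x \in `[a, b - (b - a) * n.+2%:R^-1] -> 0 < b - x.
  rewrite in_itv/= => /andP[_]; rewrite lerBrDl -lerBrDr.
  by apply: lt_le_trans; rewrite mulr_gt0 ?invr_gt0 ?ltr0n.
(* A zero integral is added to match the exhaustion lemma with [g := 0]. *)
rewrite -[RHS]add0e -(integral0 lebesgue_measure
  (\bigcup_n [set` `[a, b - (b - a) * n.+2%:R^-1]])).
apply: (@ge0_integral_bigcup_FTC2_diff R _ (cst 0) (fun s => - ((b - s) `^ p / p))
  (fun=> a) (fun n => b - (b - a) * n.+2%:R^-1)).
- by move=> n; rewrite ltrBrDl -ltrBrDr.
- by move=> m n _.
- move=> m n mn; rewrite lerB// ler_pM2l// lef_pV2 ?posrE ?ltr0n//.
  by rewrite ler_nat.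
- by move=> n x _; rewrite powR_ge0.
- by move=> n x _.
- move=> n x /pos x0; apply: (continuous_comp (f := fun s => b - s) (g := @powR R ^~ (p - 1))).
    by apply: cvgB; [exact: cvg_cst|exact: cvg_id].
  exact: continuous_powR_gt0.
- by move=> n x _; exact: cvg_cst.
- move=> n x /pos x0; have dp := is_derive1_powR p x0.
  have dc : is_derive x 1 (fun s => (b - s) `^ p) (p * (b - x) `^ (p - 1) * (0 - 1)).
    exact: (is_derive1_comp (f := @powR R ^~ p) (g := fun s => b - s)).
  apply: is_derive_eq.
  by rewrite /GRing.scale/=; field; rewrite gt_eqF.
- suff lim : (b - a) `^ p / p - ((b - a) * n.+2%:R^-1) `^ p / p @[n --> \oo] -->
      (b - a) `^ p / p.
    by under eq_fun do rewrite opprB addrCA subrr addr0 opprK addrC.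
  rewrite -[X in _ --> X]subr0.
  apply: cvgB; first exact: cvg_cst.
  rewrite -(mul0r p^-1); apply: cvgMr_tmp.
  have /cvg_at_rightP := powR_cvg0 p0; apply; split=> [n|].
    by rewrite mulr_gt0 ?invr_gt0 ?ltr0n.
  rewrite -(mulr0 (b - a)); apply: cvgMl_tmp.
  by rewrite (cvg_shiftS (@harmonic R)); exact: cvg_harmonic.
Qed.

Lemma L1_kernel_diag {R : realType} (alpha : R) (t : nat -> R) (n : nat) :
  0 < alpha < 1 -> t n.-1 < t n ->
  L1_kernel alpha t n n = tstep t n `^ (- alpha) / Gamma (2 - alpha).
Proof.
move=> /andP[a0 a1] tn; have d0 : 0 < tstep t n by rewrite /tstep subr_gt0.
have p0 : 0 < 1 - alpha by rewrite subr_gt0.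
have p01 : 0 < 1 - alpha <= 1 by rewrite p0/=; lra.
have G0 := Gamma_gt0 (1 - alpha) p01.
rewrite /L1_kernel /omega /Rintegral.
have -> : (\int[lebesgue_measure]_(s in `[t n.-1, t n])
     ((t n - s) `^ (1 - alpha - 1) / Gamma (1 - alpha))%:E =
     (Gamma (1 - alpha))^-1%:E * (tstep t n `^ (1 - alpha) / (1 - alpha))%:E)%E.
  rewrite -integral_powR_endpoint//.
  under eq_integral do rewrite mulrC EFinM.
  rewrite ge0_integralZl//=.
  - apply/measurable_EFinP; apply: measurable_funTS.
    apply: (measurableT_comp (measurable_powR _)).
    exact: measurable_funB.
  - by move=> s _; rewrite lee_fin powR_ge0.
  - by rewrite lee_fin invr_ge0 ltW.
rewrite -EFinM /=.
have -> : 2 - alpha = 1 - alpha + 1 by lra.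
rewrite GammaS// powRB ?gt_eqF ?implybT// powRr1 ?ltW// powRN.
by field; rewrite !gt_eqF ?powR_gt0.
Qed.

Lemma L1_kernel_diag_ge {R : realType} (alpha kappa : R) (t : nat -> R) (n : nat) :
  0 < alpha < 1 -> 0 < kappa -> t n.-1 < t n ->
  tstep t n <= 1 / ((kappa * Gamma (2 - alpha)) `^ (1 / alpha)) ->
  kappa <= L1_kernel alpha t n n.
Proof.
move=> a01 k0 tn; have /andP[a0 a1] := a01.
have d0 : 0 < tstep t n by rewrite /tstep subr_gt0.
have G0 : 0 < Gamma (2 - alpha).
  have -> : 2 - alpha = 1 - alpha + 1 by lra.
  rewrite GammaS ?mulr_gt0 ?Gamma_gt0//; lra.
have kG0 := mulr_gt0 k0 G0.
move=> tauk; rewrite L1_kernel_diag// ler_pdivlMr//.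
move: tauk; rewrite !div1r => tauk.
(* Inverting both sides reduces the goal to tau^alpha <= 1 / (kappa Gamma(2 - alpha)), which is the
   hypothesis raised to the power alpha. *)
rewrite -(invrK (kappa * _)) powRN lef_pV2 ?posrE ?powR_gt0 ?invr_gt0//.
have -> : (kappa * Gamma (2 - alpha))^-1 =
    ((kappa * Gamma (2 - alpha)) `^ alpha^-1)^-1 `^ alpha.
  rewrite -powRN -powRrM mulNr mulVf ?gt_eqF// powR_inv1 ?ltW//.
by apply: ge0_ler_powR; rewrite ?nnegrE ?invr_ge0 ?powR_ge0 ?(ltW a0) ?(ltW d0).
Qed.

(** * Maxima of periodic grid functions *)

Lemma periodic_intmul {T : Type} (f : int -> T) (d : int) :
  (forall x, f (x + d) = f x) -> forall (k x : int), f (x + k * d) = f x.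
Proof.
move=> fd; elim/int_rect => [x|n IH x|n IH x]; first by rewrite mul0r addr0.
  by rewrite intS mulrDl mul1r addrA IH fd.
by rewrite intS opprD mulrDl mulN1r addrA IH -[in RHS](subrK d x) fd.
Qed.

(** By Euclidean division of both indices by [M], every value is already taken on a finite M by M
    cell, where a maximum exists. *)
Lemma Vh_max {R : realType} (M : nat) (v : int -> int -> R) : (0 < M)%N ->
  Vh M v -> exists i j, forall i' j', v i' j' <= v i j.
Proof.
move=> M0 vM; pose V (p : 'I_M * 'I_M) := v p.1%:Z p.2%:Z.
have [p _ pmax] := arg_maxP (P := xpredT) V (i0 := (Ordinal M0, Ordinal M0)) isT.
exists p.1%:Z, p.2%:Z => i j.
have red k : exists m : 'I_M, k = m%:Z + (k %/ M%:Z)%Z * M%:Z.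
  have Mn : M%:Z != 0 by rewrite eqz_nat -lt0n.
  have : (`|(k %% M%:Z)%Z|%N < M)%N.
    by rewrite -ltz_nat gez0_abs ?modz_ge0// ltz_pmod// ltz_nat.
  move=> kM; exists (Ordinal kM) => /=.
  by rewrite gez0_abs ?modz_ge0// addrC -divz_eq.
have [m km] := red i; have [n kn] := red j.
have -> : v i j = V (m, n).
  rewrite /V/= km (periodic_intmul (v ^~ j)); last by move=> x; have [] := vM x j.
  by rewrite kn (periodic_intmul (v m)); last by move=> x; have [] := vM m x.
exact: pmax.
Qed.

(** * The one-step operator and its maximum principle *)

(** With [a] the diagonal kernel, this gathers all terms of one time step that contain the unknown
    level. *)
Definition implicit_op {R : realType} (a kappa eps h : R) (v : int -> int -> R)
    (i j : int) : R :=
  a * v i j + kappa * chem_potential eps h v i j.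

(** Separates a pointwise cubic, increasing when [kappa <= a], from the four neighbours, whose total
    weight 4 K is matched by the linear coefficient of the cubic. *)
Lemma implicit_opE {R : realType} (a kappa eps h : R) (v : int -> int -> R) i j :
  let K := kappa * eps ^+ 2 / h ^+ 2 in
  implicit_op a kappa eps h v i j =
  (a - kappa + 4 * K) * v i j + kappa * v i j ^+ 3 -
  K * (v (i + 1) j + v (i - 1) j + v i (j + 1) + v i (j - 1)).
Proof. by rewrite /implicit_op /chem_potential /laplacian_h; ring. Qed.

Lemma cubic_mono {R : realType} (A kappa : R) : 0 <= A -> 0 < kappa ->
  {mono (fun x => A * x + kappa * x ^+ 3) : x y / x <= y}.
Proof.
move=> A0 k0; apply: le_mono => x y xy.
apply: ler_ltD; first by rewrite ler_wpM2l// ltW.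
rewrite ltr_pM2l// -subr_gt0.
(* The factor x^2 + xy + y^2 is written as a sum of squares, strictly positive through (y - x)^2. *)
have -> : y ^+ 3 - x ^+ 3 = (y - x) * (3 / 4 * (y + x) ^+ 2 + (y - x) ^+ 2 / 4) by field.
rewrite mulr_gt0 ?subr_gt0//.
have : 0 < (y - x) ^+ 2 by rewrite exprn_gt0 ?subr_gt0.
by have := sqr_ge0 (y + x); lra.
Qed.

(** At a maximum of u - v, four times its value is at least the sum over the neighbours, so the
    K-terms have a favourable sign and the inequality passes to the cubics, hence to u and v
    there. *)
Lemma implicit_op_comparison {R : realType} (a kappa eps h : R) (M : nat)
    (u v : int -> int -> R) :
  (0 < M)%N -> 0 < kappa -> kappa <= a -> Vh M u -> Vh M v ->
  (forall i j, implicit_op a kappa eps h u i j <= implicit_op a kappa eps h v i j) ->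
  forall i j, u i j <= v i j.
Proof.
move=> M0 k0 ka uM vM uv i j.
have [|p [q pq]] := @Vh_max R M (fun i j => u i j - v i j) M0.
  by move=> x y; have [-> ->] := uM x y; have [-> ->] := vM x y.
rewrite -subr_le0 (le_trans (pq i j))// subr_le0.
have ak0 : 0 <= a - kappa by rewrite subr_ge0.
(* The cubic is compared with coefficient [a - kappa] only: the remaining 4 K is spent on the
   neighbours. *)
rewrite -(cubic_mono _ _ ak0 k0)/=.
have := uv p q; rewrite !implicit_opE.
set K := _ / _ ^+ 2.
have K0 : 0 <= K by rewrite divr_ge0 ?sqr_ge0// mulr_ge0 ?sqr_ge0// ltW.
have := mulr_ge0 K0 (_ : 0 <= (u p q - v p q) *+ 4 -
  ((u (p + 1) q - v (p + 1) q) + (u (p - 1) q - v (p - 1) q) +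
   (u p (q + 1) - v p (q + 1)) + (u p (q - 1) - v p (q - 1)))).
have := pq (p + 1) q; have := pq (p - 1) q; have := pq p (q + 1); have := pq p (q - 1).
move=> h1 h2 h3 h4 /(_ ltac:(lra)).
lra.
Qed.

Lemma implicit_op_inj {R : realType} (a kappa eps h : R) (M : nat)
    (u v : int -> int -> R) :
  (0 < M)%N -> 0 < kappa -> kappa <= a -> Vh M u -> Vh M v ->
  (forall i j, implicit_op a kappa eps h u i j = implicit_op a kappa eps h v i j) ->
  u = v.
Proof.
move=> M0 k0 ka uM vM uv; apply/funext => i; apply/funext => j; apply/le_anti.
by apply/andP; split; apply: (implicit_op_comparison a kappa eps h M) i j => // i j; rewrite uv.
Qed.

(** * Existence for one step *)

Lemma cubic_surj {R : realType} (A kappa y : R) : 0 <= A -> 0 < kappa ->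
  exists x, A * x + kappa * x ^+ 3 = y.
Proof.
(* Since b >= 1, kappa b^3 >= kappa b = kappa + |y|, so the odd cubic takes values on both sides of
   y at -b and b. *)
move=> A0 k0; pose b := 1 + `|y| / kappa.
have b1 : 1 <= b by rewrite lerDl divr_ge0// ltW.
have b0 : 0 <= b by apply: le_trans b1.
have yb : `|y| <= A * b + kappa * b ^+ 3.
  have : kappa * b <= kappa * b ^+ 3 by rewrite ler_pM2l// ler_eXnr.
  have : kappa * b = kappa + `|y| by rewrite /b; field; rewrite gt_eqF.
  have : 0 <= A * b by rewrite mulr_ge0.
  lra.
have [| | |x _ <-] := @IVT R (fun x => A * x + kappa * x ^+ 3) (- b) b y.
- lra.
- apply: continuous_subspaceT => x.
  apply: cvgD; apply: cvgMl_tmp; first exact: cvg_id.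
  exact: exprn_continuous.
- have -> : A * - b + kappa * (- b) ^+ 3 = - (A * b + kappa * b ^+ 3) by ring.
  rewrite ge_min le_max; move: yb; rewrite ler_norml => /andP[-> ->].
  by rewrite orbT.
by exists x.
Qed.

(* Knaster-Tarski; the last clause holds because the fixed point is the greatest
   one below [B]. *)
Lemma monotone_fixpoint {R : realType} {I : Type} (F : (I -> R) -> I -> R) (B : R) :
    (forall u v, (forall x, u x <= v x) -> forall x, F u x <= F v x) ->
    (exists2 u, (forall x, u x <= B) & (forall x, u x <= F u x)) ->
    (forall x, F (fun=> B) x <= B) ->
  exists2 v, (forall x, F v x = v x) &
    forall s : I -> I, (forall u x, F (u \o s) x = F u (s x)) ->
      forall x, v (s x) <= v x.
Proof.
move=> Fmono [u0 u0B u0F] FB.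
pose S : set (I -> R) := [set u | (forall x, u x <= B) /\ (forall x, u x <= F u x)].
pose v x := sup [set u x | u in S].
have uv u x : S u -> u x <= v x.
  move=> Su; apply: ub_le_sup; last by exists u.
  by exists B => _ [w [wB _] <-].
have vle x c : (forall u, S u -> u x <= c) -> v x <= c.
  move=> H; apply: ge_sup; first by exists (u0 x), u0.
  by move=> _ [u Su <-]; exact: H.
have vB x : v x <= B by apply: vle => u [].
have vF x : v x <= F v x.
  apply: vle => u Su; apply: le_trans (Su.2 x) _.
  by apply: Fmono => y; exact: uv.
(* Membership of [F v] in [S] yields the reverse inequality F v <= v. *)
have SFv : S (F v).
  split=> x; last exact: Fmono.
  by apply: le_trans (FB x); exact: Fmono.
exists v => [x|s Fs x]; first by apply/le_anti; rewrite vF uv.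
apply: vle => u [uB uF].
apply: (uv (u \o s)); split=> y; first exact: uB.
by rewrite Fs; exact: uF.
Qed.

Lemma implicit_op_surj {R : realType} (a kappa eps h : R) (M : nat)
    (g : int -> int -> R) :
  (0 < M)%N -> 0 < kappa -> kappa <= a -> Vh M g ->
  exists2 v, Vh M v & forall i j, implicit_op a kappa eps h v i j = g i j.
Proof.
move=> M0 k0 ka gM; pose K := kappa * eps ^+ 2 / h ^+ 2.
have K0 : 0 <= K by rewrite divr_ge0 ?sqr_ge0// mulr_ge0 ?sqr_ge0// ltW.
pose A := a - kappa + 4 * K.
have A0 : 0 <= A by rewrite addr_ge0 ?subr_ge0// mulr_ge0.
have mono := cubic_mono A kappa A0 k0.
(* [psi] inverts the cubic; since the cubic preserves and reflects order, [psi] obeys the two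
   exchange rules below. *)
have [psi psiE] := choice (fun y => cubic_surj A kappa y A0 k0).
have psi_le y x : (psi y <= x) = (y <= A * x + kappa * x ^+ 3).
  by rewrite -mono/= psiE.
have le_psi y x : (x <= psi y) = (A * x + kappa * x ^+ 3 <= y).
  by rewrite -mono/= psiE.
have [|p [q gmax]] := @Vh_max R M (fun i j => `|g i j|) M0.
  by move=> i j; have [-> ->] := gM i j.
(* Here B >= 1 and kappa B = kappa + max |g|, so kappa B^3 dominates |g|; with A >= 4 K the
   constants -B and B are a sub- and a supersolution. *)
pose B := 1 + `|g p q| / kappa.
have B1 : 1 <= B by rewrite lerDl divr_ge0// ltW.
have B0 : 0 <= B by apply: le_trans B1.
have gB i j : `|g i j| <= kappa * B ^+ 3.
  have : kappa * B <= kappa * B ^+ 3 by rewrite ler_pM2l// ler_eXnr.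
  have : kappa * B = kappa + `|g p q| by rewrite /B; field; rewrite gt_eqF.
  by have := gmax i j; lra.
have AB : A * B = (a - kappa) * B + K * (B *+ 4) by rewrite /A; ring.
have aB : 0 <= (a - kappa) * B by rewrite mulr_ge0 ?subr_ge0.
pose nb (v : int * int -> R) i j :=
  v (i + 1, j) + v (i - 1, j) + v (i, j + 1) + v (i, j - 1).
(* At a fixed point of [F], the cubic equals g plus K times the neighbour sum, which is the equation
   to solve. *)
pose F v x := psi (g x.1 x.2 + K * nb v x.1 x.2).
have [||| v Fv vs] := @monotone_fixpoint R (int * int)%type F B.
- move=> u v uv x; rewrite le_psi psiE lerD2l ler_wpM2l//.
  by rewrite !lerD.
- exists (fun=> - B) => x; first lra.
  have := gB x.1 x.2; rewrite ler_norml le_psi /nb => /andP[gx _].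
  have -> : - B + - B + - B + - B = - (B *+ 4) by ring.
  have -> : A * - B + kappa * (- B) ^+ 3 = - (A * B + kappa * B ^+ 3) by ring.
  lra.
- move=> x; have := gB x.1 x.2; rewrite ler_norml psi_le /nb => /andP[_ gx].
  have -> : B + B + B + B = B *+ 4 by ring.
  lra.
(* The fixed point only satisfies v o s <= v; applying this to [s] and to its inverse [s'] gives
   equality. *)
have per (s s' : int * int -> int * int) :
    (forall u x, F (u \o s) x = F u (s x)) ->
    (forall u x, F (u \o s') x = F u (s' x)) ->
    cancel s s' -> forall x, v (s x) = v x.
  move=> Fs Fs' ss' x; apply/le_anti; rewrite vs//=.
  by rewrite -[leLHS](congr1 v (ss' x)) vs.
have g1 i j : g (i - M%:Z) j = g i j by have [<- _] := gM (i - M%:Z) j; rewrite subrK.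
have g2 i j : g i (j - M%:Z) = g i j by have [_ <-] := gM i (j - M%:Z); rewrite subrK.
exists (fun i j => v (i, j)) => i j.
  split.
    (* Shifts by M and -M commute with [F], because [g] is periodic and neighbours shift along. *)
    apply: (per (fun x => (x.1 + M%:Z, x.2)) (fun x => (x.1 - M%:Z, x.2)) _ _ _ (i, j)).
    - move=> u x; rewrite /F/= (gM _ _).1 /nb/=.
      by rewrite ![_ + M%:Z + _]addrAC.
    - move=> u x; rewrite /F/= g1 /nb/=.
      by rewrite ![_ - M%:Z + _]addrAC.
    - by move=> [x y]/=; rewrite addrK.
  apply: (per (fun x => (x.1, x.2 + M%:Z)) (fun x => (x.1, x.2 - M%:Z)) _ _ _ (i, j)).
  - move=> u x; rewrite /F/= (gM _ _).2 /nb/=.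
    by rewrite ![_ + M%:Z + _]addrAC.
  - move=> u x; rewrite /F/= g2 /nb/=.
    by rewrite ![_ - M%:Z + _]addrAC.
  - by move=> [x y]/=; rewrite addrK.
rewrite implicit_opE -/K -/A.
have := psiE (g i j + K * nb v i j).
rewrite [psi _](Fv (i, j)) => ->; rewrite /nb; ring.
Qed.

(** * Time stepping: existence and uniqueness of the whole sequence *)

(** Only the summand [k = n.+1] contains the new level; the others form a right-hand side made of
    earlier levels. *)
Lemma L1_step_eq {R : realType} (alpha kappa eps h : R) (t : nat -> R) (n : nat)
    (psi : nat -> int -> int -> R) i j :
  (\sum_(1 <= k < n.+2) L1_kernel alpha t n.+1 k * (psi k i j - psi k.-1 i j)
    = - kappa * chem_potential eps h (psi n.+1) i j) <->
  implicit_op (L1_kernel alpha t n.+1 n.+1) kappa eps h (psi n.+1) i j =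
  L1_kernel alpha t n.+1 n.+1 * psi n i j -
  \sum_(1 <= k < n.+1) L1_kernel alpha t n.+1 k * (psi k i j - psi k.-1 i j).
Proof.
rewrite big_nat_recr//= /implicit_op; split=> H; lra.
Qed.

(** Levels are indexed by [nat] rather than by ordinals, so that the induction on [N] changes a
    single value of the sequence and keeps its type. *)
Lemma L1_scheme_exists {R : realType} (alpha kappa eps h : R) (M N : nat)
    (t : nat -> R) (v0 : int -> int -> R) :
  (0 < M)%N -> 0 < kappa -> Vh M v0 ->
  (forall n, (1 <= n <= N)%N -> kappa <= L1_kernel alpha t n n) ->
  exists psi : nat -> int -> int -> R,
    [/\ forall n, Vh M (psi n), psi 0%N = v0 &
      forall n, (1 <= n <= N)%N -> forall i j,
        \sum_(1 <= k < n.+1) L1_kernel alpha t n k * (psi k i j - psi k.-1 i j)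
        = - kappa * chem_potential eps h (psi n) i j].
Proof.
move=> M0 k0 v0M; elim: N => [|N IH] ker.
  by exists (fun=> v0); split=> // n; rewrite leqn0; case: n.
have [|psi [psiM psi0 psiE]] := IH.
  by move=> n /andP[n1 nN]; apply: ker; rewrite n1 leqW.
pose a k := L1_kernel alpha t N.+1 k.
pose g i j := a N.+1 * psi N i j -
  \sum_(1 <= k < N.+1) a k * (psi k i j - psi k.-1 i j).
have gM : Vh M g.
  move=> i j; split; rewrite /g.
    rewrite (psiM _ _ _).1; congr (_ - _); apply: eq_bigr => k _.
    by rewrite !(psiM _ _ _).1.
  rewrite (psiM _ _ _).2; congr (_ - _); apply: eq_bigr => k _.
  by rewrite !(psiM _ _ _).2.
have kaN : kappa <= a N.+1 by apply: ker; rewrite leqnn.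
have [v vM vE] := implicit_op_surj (a N.+1) kappa eps h M g M0 k0 kaN gM.
pose psi' n := if n == N.+1 then v else psi n.
have psi'E n : (n <= N)%N -> psi' n = psi n.
  by move=> nN; rewrite /psi' ltn_eqF.
(* For n <= N + 1 these sums involve only levels up to N, which the new value leaves unchanged. *)
have sumE n m i j : (n <= N.+1)%N ->
    \sum_(1 <= k < n) L1_kernel alpha t m k * (psi' k i j - psi' k.-1 i j) =
    \sum_(1 <= k < n) L1_kernel alpha t m k * (psi k i j - psi k.-1 i j).
  move=> nN; apply: eq_big_nat => k /andP[_ kn].
  have kN : (k <= N)%N by rewrite -ltnS (leq_trans kn).
  by rewrite !psi'E// (leq_trans (leq_pred _)).
exists psi'; split=> [n|//|n /andP[n1]].
  by rewrite /psi'; case: ifP.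
rewrite leq_eqVlt => /predU1P[->|nN] i j; last first.
  by rewrite sumE// psi'E// psiE// n1.
by apply/L1_step_eq; rewrite sumE// (psi'E N)// [psi' N.+1]ifT ?eqxx//.
Qed.

Theorem theorem2p1 (R : realType) (alpha kappa eps L T : R) (M N : nat)
    (t : nat -> R) (Phi0 : R -> R -> R)
    (alpha_gt0 : 0 < alpha) (alpha_lt1 : alpha < 1)
    (kappa_gt0 : 0 < kappa) (eps_gt0 : 0 < eps)
    (L_gt0 : 0 < L) (M_gt0 : (0 < M)%N)
    (Phi0_periodic : forall x y : R,
       Phi0 (x + L) y = Phi0 x y /\ Phi0 x (y + L) = Phi0 x y)
    (N_gt0 : (0 < N)%N) (t_0 : t 0%N = 0) (t_N : t N = T)
    (t_incr : forall n : nat, (1 <= n <= N)%N -> t n.-1 < t n)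
    (tau_le : forall n : nat, (1 <= n <= N)%N ->
       tstep t n <= 1 / ((kappa * Gamma (2 - alpha)) `^ (1 / alpha))) :
  exists! phi : 'I_N.+1 -> int -> int -> R,
    L1_solution alpha kappa eps (L / M%:R) M t Phi0 phi.
Proof.
set h := L / M%:R.
have ker n : (1 <= n <= N)%N -> kappa <= L1_kernel alpha t n n.
  move=> nN; apply: L1_kernel_diag_ge => //; first by rewrite alpha_gt0.
    exact: t_incr.
  exact: tau_le.
have v0M : Vh M (fun i j : int => Phi0 (i%:~R * h) (j%:~R * h)).
  (* M grid steps make up one spatial period L, so the sampled initial function lies in [Vh M]. *)
  have shift (i : int) : (i + M%:Z)%:~R * h = i%:~R * h + L.
    rewrite intrD mulrDl; congr (_ + _).
    by rewrite /h -pmulrn mulrC divfK// pnatr_eq0 -lt0n.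
  by move=> i j; rewrite !shift; exact: Phi0_periodic.
have [psi [psiM psi0 psiE]] := L1_scheme_exists alpha kappa eps h M N t _
  M_gt0 kappa_gt0 v0M ker.
exists (fun n => psi n); split=> [|phi [phiM phi0 phiE]].
  split=> [n|i j|n nN i j]; [exact: psiM|by rewrite psi0|].
  have /andP[_ n_le] := nN.
  rewrite inordK ?ltnS// -psiE//.
  apply: eq_big_nat => k /andP[_ kn].
  have kN : (k <= N)%N by rewrite (leq_trans _ n_le).
  by rewrite !inordK// ltnS (leq_trans (leq_pred _)).
(* Strong induction is required: the equation at a level involves the whole history, which must
   agree before [implicit_op_inj] applies. *)
have step n : (n <= N)%N -> psi n = phi (inord n).
  have [m] := ubnP n; elim: m n => // m IH [_ _|n nm nN].
    apply/funext => i; apply/funext => j.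
    rewrite psi0 -phi0; congr (phi _ i j); apply/val_inj.
    by rewrite /= inordK.
  apply: (implicit_op_inj (L1_kernel alpha t n.+1 n.+1) kappa eps h M) => //.
    exact: ker.
  move=> i j; rewrite (L1_step_eq alpha kappa eps h t n psi i j).1 ?psiE//.
  rewrite (L1_step_eq alpha kappa eps h t n (fun n => phi (inord n)) i j).1 ?phiE//.
  rewrite IH ?(ltnW nN)//; congr (_ - _); apply: eq_big_nat => k /andP[_ kn].
  rewrite !IH//.
    - by rewrite (leq_ltn_trans (leq_pred _)) ?(leq_trans kn).
    - by rewrite (leq_trans (leq_pred _)) ?(leq_trans (ltnW kn)).
    - by rewrite (leq_trans kn).
    - by rewrite (leq_trans (ltnW kn)).
by apply/funext => n; rewrite step ?inord_val// -ltnS.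
Qed.
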